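(* Let $R$ be a normal domain. Each semidualizing $R$-module $C$ is a reflexive module of rank 1, so that sending the isomorphism class of $C$ to its class in $\operatorname{Cl}(R)$ gives a natural inclusion $\mathfrak{S}_0(R)\subseteq\operatorname{Cl}(R)$.
   Context: All rings are commutative Noetherian with identity. A finitely generated module $C$ over a ring $R$ is semidualizing if the homothety map $R\to\operatorname{Hom}_R(C,C)$ is an isomorphism and $\operatorname{Ext}^i_R(C,C)=0$ for all $i\geq 1$. $\mathfrak{S}_0(R)$ denotes the set of isomorphism classes of semidualizing $R$-modules. For a normal domain $R$ write $(-)^\star=\operatorname{Hom}_R(-,R)$. An $R$-module $M$ is reflexive if it is finitely generated and the natural biduality map $M\to M^{\star\star}$ is bijective. The divisor class group $\operatorname{Cl}(R)$ is the set of isomorphism classes of reflexive $R$-modules of rank 1, with the abelian group structure $[M]+[N]=[(M\otimes_R N)^{\star\star}]$ and $[M]-[N]=[\operatorname{Hom}_R(N,M)]$. *)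

(* Defs.v *)
From HB Require Import structures.
From mathcomp Require Import all_boot all_order all_algebra.
From mathcomp Require Import boolp.

Set Implicit Arguments.
Unset Strict Implicit.
Unset Printing Implicit Defensive.

Import GRing.Theory.
Local Open Scope ring_scope.

Definition HomMod (R : comNzRingType) (M N : lmodType R) := {linear M -> N}.

Section HomModule.
Variables (R : comNzRingType) (M N : lmodType R).

HB.instance Definition _ := gen_eqMixin (HomMod M N).
HB.instance Definition _ := gen_choiceMixin (HomMod M N).

Lemma hom_ext (f g : HomMod M N) : (f : M -> N) =1 (g : M -> N) -> f = g.
Proof.
move: f g => [f [[fA] [fZ]]] [g [[gA] [gZ]]] /= /funext fg; subst g.
by congr (GRing.Linear.Pack (GRing.Linear.Class _ _));
  [congr (Algebra.isNmodMorphism.Axioms_ _) | congr (GRing.isScalable.Axioms_ _)];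
  apply: Prop_irrelevance.
Qed.

Definition hom0 : HomMod M N := GRing.Linear.clone _ _ _ _ (\0 : M -> N) _.
Definition hom_add (f g : HomMod M N) : HomMod M N :=
  GRing.Linear.clone _ _ _ _ ((f : M -> N) \+ (g : M -> N)) _.
Definition hom_opp (f : HomMod M N) : HomMod M N :=
  GRing.Linear.clone _ _ _ _ (\- (f : M -> N)) _.
Definition hom_scale (a : R) (f : HomMod M N) : HomMod M N :=
  GRing.Linear.clone _ _ _ _ (a \*: (f : M -> N)) _.

Lemma hom_addA : associative hom_add.
Proof. by move=> f g h; apply: hom_ext => x /=; rewrite addrA. Qed.
Lemma hom_addC : commutative hom_add.
Proof. by move=> f g; apply: hom_ext => x /=; rewrite addrC. Qed.
Lemma hom_add0 : left_id hom0 hom_add.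
Proof. by move=> f; apply: hom_ext => x /=; rewrite add0r. Qed.
Lemma hom_addN : left_inverse hom0 hom_opp hom_add.
Proof. by move=> f; apply: hom_ext => x /=; rewrite addNr. Qed.

HB.instance Definition _ :=
  GRing.isZmodule.Build (HomMod M N) hom_addA hom_addC hom_add0 hom_addN.

Lemma hom_scaleA a b f : hom_scale a (hom_scale b f) = hom_scale (a * b) f.
Proof. by apply: hom_ext => x /=; rewrite scalerA. Qed.
Lemma hom_scale1 : left_id 1 hom_scale.
Proof. by move=> f; apply: hom_ext => x /=; rewrite scale1r. Qed.
Lemma hom_scaleDr : right_distributive hom_scale +%R.
Proof. by move=> a f g; apply: hom_ext => x /=; rewrite scalerDr. Qed.
Lemma hom_scaleDl f : {morph hom_scale^~ f : a b / a + b}.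
Proof. by move=> a b; apply: hom_ext => x /=; rewrite scalerDl. Qed.

HB.instance Definition _ := GRing.Zmodule_isLmodule.Build R (HomMod M N)
  hom_scaleA hom_scale1 hom_scaleDr hom_scaleDl.

End HomModule.

Section Modules.
Variable R : comNzRingType.

(* Every subset of R is a [{pred R}], by the classical [asbool]. *)
Definition noetherian : Prop :=
  forall I : {pred R^o}, submod_closed I ->
  exists n (g : 'I_n -> R),
    forall x : R, x \in I <-> exists a : 'I_n -> R, x = \sum_i a i * g i.

Definition finitely_generated (M : lmodType R) : Prop :=
  exists n (g : 'I_n -> M),
    forall m : M, exists a : 'I_n -> R, m = \sum_i a i *: g i.

Definition isomorphic (M N : lmodType R) : Prop :=
  exists f : {linear M -> N}, bijective f.

Lemma isomorphic_refl (M : lmodType R) : isomorphic M M.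
Proof.
by exists (GRing.Linear.clone _ _ _ _ (@idfun M) _); exists id.
Qed.

Lemma isomorphic_sym (M N : lmodType R) : isomorphic M N -> isomorphic N M.
Proof.
case=> f [g fK gK]; have gL := can2_linear fK gK.
pose gM := GRing.isLinear.Build R N M *:%R g gL.
by exists (HB.pack_for {linear N -> M} g gM); exists f.
Qed.

Lemma isomorphic_trans (L M N : lmodType R) :
  isomorphic L M -> isomorphic M N -> isomorphic L N.
Proof.
move=> [f fB] [g gB].
by exists (GRing.Linear.clone _ _ _ _ (g \o f) _); apply: bij_comp.
Qed.

Definition projective (P : lmodType R) : Prop :=
  forall (M N : lmodType R) (f : {linear M -> N}) (g : {linear P -> N}),
    (forall y, exists x, f x = y) ->
    exists h : {linear P -> M}, forall p, f (h p) = g p.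

(* ... -> res_obj 1 -> res_obj 0 -> M -> 0 *)
Record projective_resolution (M : lmodType R) := ProjectiveResolution {
  res_obj :> nat -> lmodType R;
  res_diff : forall i, {linear res_obj i.+1 -> res_obj i};
  res_aug : {linear res_obj 0%N -> M};
  res_projective : forall i, projective (res_obj i);
  res_aug_surj : forall m, exists p, res_aug p = m;
  res_exact0 : forall p, res_aug p = 0 <-> exists q, res_diff 0 q = p;
  res_exactS : forall i p,
    res_diff i p = 0 <-> exists q, res_diff i.+1 q = p
}.

(* H^i (Hom_R(P, N)) = 0: every cocycle is a coboundary. *)
Definition cohomology_vanishes (M N : lmodType R)
    (P : projective_resolution M) (i : nat) : Prop :=
  match i with
  | 0 => forall f : HomMod (P 0%N) N,
      (forall p, f (res_diff P 0 p) = 0) -> f = 0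
  | j.+1 => forall f : HomMod (P j.+1) N,
      (forall p, f (res_diff P j.+1 p) = 0) ->
      exists g : HomMod (P j) N, forall p, f p = g (res_diff P j p)
  end.

(* Ext^i_R(M, N) = 0.  By the comparison theorem the choice of projective
   resolution is immaterial, and projective resolutions exist. *)
Definition Ext_vanishes (i : nat) (M N : lmodType R) : Prop :=
  exists P : projective_resolution M, cohomology_vanishes N P i.

Definition homothety (M : lmodType R) (r : R) : HomMod M M :=
  hom_scale r (GRing.Linear.clone _ _ _ _ (@idfun M) _).

Lemma homothety_is_linear (M : lmodType R) :
  linear (homothety M : R^o -> HomMod M M).
Proof.
by move=> a r s; apply: hom_ext => m /=; rewrite scalerDl -[a *: r]/(a * r) scalerA.
Qed.

HB.instance Definition _ (M : lmodType R) :=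
  GRing.isLinear.Build R R^o (HomMod M M) *:%R (homothety M)
    (homothety_is_linear M).

Definition semidualizing (C : lmodType R) : Prop :=
  [/\ finitely_generated C,
      bijective (homothety C) &
      forall i : nat, (1 <= i)%N -> Ext_vanishes i C C].

Definition dual (M : lmodType R) : lmodType R := HomMod M R^o.

Section Biduality.
Variable M : lmodType R.

Definition evaluation (m : M) (f : dual M) : R^o := (f : HomMod M R^o) m.

Lemma evaluation_is_linear (m : M) : linear (evaluation m).
Proof. by []. Qed.

HB.instance Definition _ (m : M) :=
  GRing.isLinear.Build R (dual M) R^o *:%R (evaluation m)
    (evaluation_is_linear m).

Definition biduality (m : M) : dual (dual M) :=
  GRing.Linear.clone _ _ _ _ (evaluation m) _ : HomMod (dual M) R^o.

Lemma biduality_is_linear : linear biduality.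
Proof. by move=> a x y; apply: hom_ext => f; apply: linearP. Qed.

HB.instance Definition _ :=
  GRing.isLinear.Build R M (dual (dual M)) *:%R biduality biduality_is_linear.

End Biduality.

Definition reflexive_module (M : lmodType R) : Prop :=
  finitely_generated M /\ bijective (@biduality M).

Definition iso_class (M : lmodType R) : lmodType R -> Prop :=
  fun N => isomorphic M N.

Lemma iso_classP (M N : lmodType R) :
  iso_class M = iso_class N <-> isomorphic M N.
Proof.
split=> [MN | MN].
  by rewrite -/(iso_class M N) MN; exact: isomorphic_refl.
apply: functional_extensionality_dep => L; apply: propositional_extensionality.
split; apply: isomorphic_trans => //; exact: isomorphic_sym.
Qed.

Definition S0 : Type :=
  {X : lmodType R -> Prop | exists2 C, semidualizing C & X = iso_class C}.

End Modules.

Arguments noetherian : clear implicits.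
Arguments S0 : clear implicits.

Section Domain.
Variable R : idomainType.

Local Notation K := {fraction R}.
Local Notation toK := (@FracField.tofrac R).

Definition normal_domain : Prop :=
  forall z : K, integralOver toK z -> exists r : R, z = toK r.

(* The maps [{linear M -> V | toK \; *:%R}] are the R-linear maps from M to
   the restriction of scalars of the K-vector space V; the universal property
   says that V, together with j, is K (x)_R M. *)
Definition is_extension_of_scalars (M : lmodType R) (V : lmodType K)
    (j : {linear M -> V | toK \; *:%R}) : Prop :=
  forall (W : lmodType K) (g : {linear M -> W | toK \; *:%R}),
    exists! h : HomMod V W, forall m, h (j m) = g m.

(* dim_K (K (x)_R M) = n *)
Definition has_rank (M : lmodType R) (n : nat) : Prop :=
  exists (V : vectType K) (j : {linear M -> V | toK \; *:%R}),
    is_extension_of_scalars j /\ \dim {:V} = n.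

(* The underlying set of the divisor class group. *)
Definition Cl : Type :=
  {X : lmodType R -> Prop |
    exists2 M, reflexive_module M /\ has_rank M 1 & X = iso_class M}.

End Domain.

Arguments normal_domain : clear implicits.
Arguments Cl : clear implicits.

(* Main.v *)
Require Import Defs.
From HB Require Import structures.
From mathcomp Require Import all_boot all_order all_algebra.
From mathcomp Require Import boolp.

Set Implicit Arguments.
Unset Strict Implicit.
Unset Printing Implicit Defensive.

Import GRing.Theory.
Local Open Scope ring_scope.

(** Let [C] be semidualizing over the Noetherian normal domain [R].  Every
    endomorphism of [C] is a homothety by a unique scalar, so every
    construction of an endomorphism gives information on [C].

    Nonzero maps out of [C] come from [functional_mod_prime]: for each prime
    [p] of [R] there is a nonzero map [C -> R / p], since [C] is faithful.
    (For a finitely generated [C], this is the nonvanishing of Hom at the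
    primes of the support.)

    - If [c] in [C] were a nonzero torsion element, some [n] would have a
      nonzero prime annihilator [p], and [C -> R / p -> C], with second map
      [a |-> a *: n], would be a nonzero homothety killed by [p].  So [C] is
      torsion-free ([semidualizing_torsionfree]).
    - For [p = 0] one gets a nonzero [f : C -> R].  For each [n] the
      endomorphism [c |-> f c *: n] is a homothety, by the scalar [f n]; that
      is [f c *: n = f n *: c] ([functional_swap]).  So [C] embeds in [R] by
      [f] and has rank 1 ([has_rank1]).
    - Let [x <> 0].  As Ext^1 (C, C) = 0, each map [C -> C / x C] lifts to an
      endomorphism of [C].  If [p = (x C : n)] is prime, lifting the
      composite [C -> R / p -> C / x C] produces a scalar [r], not a multiple
      of [x], such that [p r] is contained in [x R]
      ([associated_prime_mod_multiple]).
    - Suppose that [C] is not its bidual.  Some bidual element [xi] outside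
      [C] has a prime [p] as its annihilator modulo [C].  For every
      functional [h] and every [c] the element [h c *: xi] is the image of
      [xi h *: c], by the exchange rule [h c *: k = k c *: h] of functionals;
      so [h c] is in [p].  With [x] a nonzero value of [f], a suitable multiple
      of [xi] turns [p] into an annihilator modulo [x C], and the previous
      point yields [r].  Now [y = r / x] satisfies [y * h c \in R] for all
      [h] and [c], so multiplication by [y] preserves the dual of [C].  Hence
      all [x * y ^+ k] are in [R], so [y] is in [R] as [R] is Noetherian and
      normal; this contradicts the choice of [r]
      ([semidualizing_reflexive]).

    The map to the class group sends an isomorphism class to itself, so it is
    injective. *)

(** * Linear maps and splitting of extensions *)

Section LinearMaps.
Variable R : comNzRingType.
Implicit Types L M N E : lmodType R.

Definition linear_map M N (f : M -> N) (f_lin : linear f) : {linear M -> N} :=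
  HB.pack_for {linear M -> N} f (GRing.isLinear.Build R M N *:%R f f_lin).

Lemma factor_through_surjection L M E (p : {linear L -> M})
    (h : {linear L -> E}) :
  (forall m, exists l, p l = m) -> (forall l, p l = 0 -> h l = 0) ->
  exists s : {linear M -> E}, forall l, s (p l) = h l.
Proof.
move=> psurj ker_ph; have [q pq] := choice psurj.
have sE l l' : p l = p l' -> h l = h l'.
  move=> e; apply/eqP; rewrite -subr_eq0 -linearB; apply/eqP/ker_ph.
  by rewrite linearB e subrr.
have s_lin : linear (h \o q).
  by move=> a u v /=; rewrite -linearP; apply: sE; rewrite linearP !pq.
by exists (linear_map s_lin) => l; apply: sE; rewrite pq.
Qed.

Lemma lift_through_injection L N E (i : {linear N -> E}) (h : {linear L -> E}) :
  injective i -> (forall l, exists n, i n = h l) ->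
  exists f : {linear L -> N}, forall l, i (f l) = h l.
Proof.
move=> i_inj /choice[f fE].
have f_lin : linear f.
  by move=> a u v; apply: i_inj; rewrite linearP !fE linearP.
by exists (linear_map f_lin).
Qed.

(** Lift the augmentation [P 0 -> M] to [h : P 0 -> E] by projectivity.  On
    boundaries [h] takes values in [N], which defines a cocycle [P 1 -> N]; it
    is the coboundary of some [g : P 0 -> N], and [h - i \o g] descends to a
    section [M -> E]. *)
Lemma Ext1_vanishes_split M N E (i : {linear N -> E}) (p : {linear E -> M}) :
  Ext_vanishes 1 M N -> injective i -> (forall m, exists e, p e = m) ->
  (forall e, p e = 0 <-> exists n, i n = e) ->
  exists s : {linear M -> E}, forall m, p (s m) = m.
Proof.
move=> [P /= vanish] i_inj psurj exact.
have [h hE] := @res_projective _ _ P 0 E M p (res_aug P) psurj.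
pose hd : {linear P 1%N -> E} := linear_map
  (linearP (GRing.Linear.clone _ _ _ _ (h \o res_diff P 0) _)).
have [l|f fE] := @lift_through_injection _ _ _ i hd i_inj.
  by apply/exact; rewrite /= hE; apply/(@res_exact0 _ _ P _); exists l.
have [q|g gE] := vanish f.
  apply: i_inj; rewrite fE linear0 /=.
  have -> : res_diff P 0 (res_diff P 1 q) = 0.
    by apply/(@res_exactS _ _ P _ _); exists q.
  by rewrite linear0.
have k_lin : linear (fun y => h y - i (g y)).
  move=> a u v; rewrite [h _]linearP [g _]linearP [i _]linearP scalerBr.
  by rewrite opprD addrACA.
have [l|s sE] := @factor_through_surjection _ _ _ (res_aug P)
  (linear_map k_lin) (@res_aug_surj _ _ P).
  by move=> /(@res_exact0 _ _ P _)[q <-] /=; rewrite -gE fE subrr.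
exists s => m; have [l <-] := res_aug_surj P m.
rewrite sE /= linearB hE (_ : p (i _) = 0) ?subr0 //.
by apply/exact; eexists.
Qed.

(** * Submodules as modules *)

Definition submodule M (N : M -> Prop) : Prop :=
  N 0 /\ forall a u v, N u -> N v -> N (a *: u + v).

Section Submodule.
Variables (M : lmodType R) (N : M -> Prop).
Hypothesis subN : submodule N.

Lemma submodule0 : N 0. Proof. by case: subN. Qed.

Lemma submoduleZ a u : N u -> N (a *: u).
Proof. by case: subN => N0 Nlin Nu; rewrite -[_ *: _]addr0; apply: Nlin. Qed.

Lemma submoduleD u v : N u -> N v -> N (u + v).
Proof. by case: subN => N0 Nlin Nu Nv; rewrite -[u]scale1r; apply: Nlin. Qed.

Lemma submoduleB u v : N u -> N v -> N (u - v).
Proof.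
by move=> Nu Nv; rewrite -scaleN1r; apply: submoduleD => //; apply: submoduleZ.
Qed.

Lemma submodule_sum n (P : pred 'I_n) (g : 'I_n -> M) (a : 'I_n -> R) :
  (forall i, P i -> N (g i)) -> N (\sum_(i | P i) a i *: g i).
Proof.
move=> Ng; apply: big_ind => //; [exact: submodule0 | exact: submoduleD |].
by move=> i Pi; apply/submoduleZ/Ng.
Qed.

(** The proof is an argument so that the closure properties can be inferred
    from the predicate. *)
Definition submodule_pred of submodule N : {pred M} := fun x => `[< N x >].

Lemma submodule_pred_closed : submod_closed (submodule_pred subN).
Proof.
split; first exact/asboolP/submodule0.
by move=> a u v /asboolP Nu /asboolP Nv; apply/asboolP; case: subN => _; apply.
Qed.

HB.instance Definition _ :=
  GRing.isSubmodClosed.Build R M (submodule_pred subN) submodule_pred_closed.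

Definition submodule_type := {x : M | submodule_pred subN x}.
HB.instance Definition _ := SubType.on submodule_type.
HB.instance Definition _ := Choice.on submodule_type.
HB.instance Definition _ := [SubChoice_isSubLmodule of submodule_type by <:].

Lemma submodule_typeP (x : submodule_type) : N (val x).
Proof. exact/asboolP/(valP x). Qed.

Definition submodule_elt x (Nx : N x) : submodule_type := Sub x (asboolT Nx).
End Submodule.

End LinearMaps.

(** * Prime annihilators in modules over Noetherian rings *)

Section PrimeAnnihilators.
Variable R : comNzRingType.

Lemma noetherian_chain_stationary (F : nat -> R^o -> Prop) :
  noetherian R -> (forall k, submodule (F k)) ->
  (forall k x, F k x -> F k.+1 x) ->
  exists k, forall l x, F l x -> F k x.
Proof.
move=> noeth subF incF.
have leF k l x : (k <= l)%N -> F k x -> F l x.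
  move=> /subnK <-; elim: (l - k)%N => // m IH /IH; exact: incF.
pose U : {pred R^o} := fun x => `[< exists k, F k x >].
have [|n [g gU]] := noeth U.
  split; first by apply/asboolP; exists 0%N; apply: submodule0.
  move=> a u v /asboolP[k Fu] /asboolP[l Fv]; apply/asboolP.
  exists (maxn k l); apply: submoduleD => //.
    by apply: submoduleZ => //; apply: leF Fu; apply: leq_maxl.
  by apply: leF Fv; apply: leq_maxr.
have /choice[k Fg] : forall i, exists k, F k (g i).
  move=> i; apply/asboolP; apply/gU; exists (fun j => (j == i)%:R).
  rewrite (bigD1 i) //= eqxx mul1r big1 ?addr0 // => j /negbTE ->.
  by rewrite mul0r.
exists (\max_i k i) => l x Flx.
have /gU[a ->] : x \in U by apply/asboolP; exists l.
apply: (submodule_sum (subF _)) => i _; apply: leF (Fg i).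
exact: leq_bigmax.
Qed.

Definition prime_set (p : R -> Prop) : Prop :=
  ~ p 1 /\ forall a b, p (a * b) -> p a \/ p b.

(** A maximal ideal among the [(N : n)] with [n] outside [N] that contain
    [(N : m)] is prime: if [a * b] is in [(N : n)] but neither factor is, then
    [(N : a n)] is a strictly larger such ideal, because it contains [b].  If
    no maximal one existed, dependent choice would give a strictly increasing
    chain of ideals. *)
Lemma exists_prime_annihilator (M : lmodType R) (N : M -> Prop) (m : M) :
  noetherian R -> submodule N -> ~ N m ->
  exists n, [/\ ~ N n, forall a, N (a *: m) -> N (a *: n) &
                prime_set (fun a => N (a *: n))].
Proof.
move=> noeth subN Nm; apply: contrapT => noprime.
pose T := {n | ~ N n /\ forall a, N (a *: m) -> N (a *: n)}.
have step (x : T) : exists y : T,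
    (forall a, N (a *: sval x) -> N (a *: sval y)) /\
    exists b, N (b *: sval y) /\ ~ N (b *: sval x).
  case: x => n [Nn mn] /=; apply: contrapT => nostep.
  apply: noprime; exists n; split=> //; split; first by rewrite scale1r.
  move=> a b Nab; apply: contrapT => /not_orP[Na Nb]; apply: nostep.
  have sub_an c : N (c *: n) -> N (c *: (a *: n)).
    by move=> Nc; rewrite scalerA mulrC -scalerA; apply: submoduleZ.
  exists (exist _ (a *: n) (conj Na (fun c Nc => sub_an c (mn c Nc)))).
  by split=> //=; exists b; rewrite scalerA mulrC.
have [next nextP] := choice step.
pose x0 : T := exist _ m (conj Nm (fun a Na => Na)).
pose F k (a : R^o) := N ((a : R) *: sval (iter k next x0)).
have [k|k a|k stat] := @noetherian_chain_stationary F noeth.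
- split; rewrite /F; first by rewrite scale0r; apply: submodule0.
  move=> b u v Fu Fv; rewrite scalerDl -[b *: u]/(b * u) -scalerA.
  by case: subN => _; apply.
- by case: (nextP (iter k next x0)) => + _; apply.
have [_ [b [Nb]]] := nextP (iter k next x0); apply.
exact: (stat k.+1 b).
Qed.

End PrimeAnnihilators.

(** * Nonzero functionals modulo a prime *)

Section FunctionalModPrime.
Variables (R : comNzRingType) (C : lmodType R).

(** A triple [L], [g], [s] such that every multiple [s *: c] lies in [L + R g]
    encodes the partial functional sending [c] to the coefficient of [g] in
    [s *: c].  The next two lemmas say that this coefficient is unique modulo
    the ideal of those [a] with [a *: g] in [L], and that it is linear in
    [c]; no quotient module has to be formed. *)
Lemma coefficient_unique (L : C -> Prop) (c g : C) (a b : R) :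
  submodule L -> L (c - b *: g) -> L (c - a *: g) -> L ((a - b) *: g).
Proof.
move=> subL Lb La; have := submoduleB subL Lb La; rewrite scalerBl.
by rewrite opprB addrC addrA subrK.
Qed.

Lemma coefficient_linear (L : C -> Prop) (u v g : C) (s a b x : R) :
  submodule L -> L (s *: u - a *: g) -> L (s *: v - b *: g) ->
  L (s *: (x *: u + v) - (x * a + b) *: g).
Proof.
move=> subL La Lb; rewrite scalerDr scalerDl opprD addrACA.
apply: submoduleD => //; rewrite !scalerA [s * x]mulrC -!scalerA -scalerBr.
exact: submoduleZ.
Qed.

Variable p : R -> Prop.

(** If [p] is prime and contains the annihilator of the finitely generated
    module [C], then [C] has a nonzero functional with values in [R / p],
    given as a coefficient function whose value at [g] is [s].  Let [L k] be
    the span of the first [k] generators, and take the least [k] such that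
    some [s] outside [p] carries [C] into [L k]; it is positive because
    nothing outside [p] annihilates [C].  Then [g] is the last of these [k]
    generators, and if [a] outside [p] satisfied [a *: g \in L k.-1], then
    [a * s], still outside [p], would carry [C] into [L k.-1]. *)
Lemma functional_mod_prime :
  finitely_generated C -> prime_set p ->
  (forall s, (forall c : C, s *: c = 0) -> p s) ->
  exists (L : C -> Prop) (g : C) (s : R),
    [/\ submodule L, ~ p s, forall c, exists a, L (s *: c - a *: g) &
        forall a, L (a *: g) -> p a].
Proof.
move=> [n [g gen]] [p1 pM] annC.
pose L k c := exists a : 'I_n -> R, c = \sum_(i < n | (i < k)%N) a i *: g i.
have subL k : submodule (L k).
  split=> [|a u v [b ->] [b' ->]].
    by exists (fun=> 0); rewrite big1 // => i _; rewrite scale0r.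
  exists (fun i => a * b i + b' i); rewrite scaler_sumr -big_split /=.
  by apply: eq_bigr => i _; rewrite scalerDl scalerA.
pose Q k := `[< exists s, ~ p s /\ forall c, L k (s *: c) >].
have exQ : exists k, Q k.
  exists n; apply/asboolP; exists 1; split=> // c; have [a ->] := gen c.
  by exists a; rewrite scale1r; apply: eq_bigl => i; rewrite ltn_ord.
have [[|k] /asboolP[s [ps sL]] kmin] := ex_minnP exQ.
  case: ps; apply: annC => c; have [a ->] := sL c.
  by rewrite big_pred0.
have nQk : ~ Q k by move=> /kmin; rewrite ltnn.
have lt_kn : (k < n)%N.
  rewrite ltnNge; apply/negP => le_nk; apply: nQk; apply/asboolP.
  exists s; split=> // c; have [a ->] := sL c; exists a; apply: eq_bigl => i.
  by have ik := leq_trans (ltn_ord i) le_nk; rewrite ik ltnW.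
pose ik := Ordinal lt_kn.
have sLg c : exists a, L k (s *: c - a *: g ik).
  have [a ->] := sL c; exists (a ik); exists a.
  rewrite (bigD1 ik) //= addrAC subrr add0r; apply: eq_bigl => i.
  by rewrite ltnS ltn_neqAle andbC.
exists (L k), (g ik), s; split=> // a Lag; apply: contrapT => pa.
apply: nQk; apply/asboolP; exists (a * s); split=> [/pM[]|c] //.
have [b Lb] := sLg c.
rewrite -scalerA -[s *: c](subrK (b *: g ik)) scalerDr.
apply: submoduleD => //; first exact: submoduleZ.
by rewrite scalerA mulrC -scalerA; apply: submoduleZ.
Qed.

End FunctionalModPrime.

(** * Torsion-freeness, functionals and reduction modulo an element *)

Section Semidualizing.
Variables (R : idomainType) (C : lmodType R).
Hypothesis noeth : noetherian R.
Hypothesis sdC : semidualizing C.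

Lemma homothety_surjective (f : C -> C) :
  linear f -> exists r, forall c, f c = r *: c.
Proof.
move=> f_lin; have [_ [u _ uK] _] := sdC.
exists (u (linear_map f_lin : HomMod C C)) => c.
by rewrite -[RHS]/(homothety C _ c) uK.
Qed.

Lemma homothety_injective r : (forall c : C, r *: c = 0) -> r = 0.
Proof.
move=> rC; have [_ homB _] := sdC; apply: (bij_inj homB).
by apply: hom_ext => c /=; rewrite rC scale0r.
Qed.

(** Take [n] whose annihilator is a prime containing [r].  The composite
    [C -> R / ann n -> C] is a nonzero homothety killed by [r]. *)
Lemma semidualizing_torsionfree r (c : C) : r *: c = 0 -> r = 0 \/ c = 0.
Proof.
move=> rc; apply: contrapT => /not_orP[r0 c0].
have sub0 : submodule (fun x : C => x = 0).
  by split=> // a u v -> ->; rewrite scaler0 addr0.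
have [n [n0 /(_ r rc) rn pr]] := exists_prime_annihilator noeth sub0 c0.
have [fgC _ _] := sdC.
have [|L [g [s [subL ps sL Lp]]]] := functional_mod_prime fgC pr.
  by move=> t /homothety_injective->; rewrite scale0r.
have [a aP] := choice sL.
have anE c' b : L (s *: c' - b *: g) -> a c' *: n = b *: n.
  move=> Lb; apply/eqP; rewrite -subr_eq0 -scalerBl; apply/eqP/Lp.
  exact: coefficient_unique Lb (aP c').
have [t tE] : exists t, forall c', a c' *: n = t *: c'.
  apply: homothety_surjective => b u v; rewrite scalerA -scalerDl; apply: anE.
  exact: coefficient_linear.
have r_t : r * t = 0.
  apply: homothety_injective => c'.
  by rewrite -scalerA -tE scalerA mulrC -scalerA rn scaler0.
have t0 : t = 0.
  by move/eqP: r_t; rewrite mulf_eq0 (negbTE (introN eqP r0)) => /eqP.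
apply: ps; rewrite -(anE g) ?subrr; last exact: submodule0.
by rewrite tE t0 scale0r.
Qed.

Lemma semidualizing_functional :
  exists (f : {linear C -> R^o}) (g : C), f g <> 0.
Proof.
have [fgC _ _] := sdC.
have pr : prime_set (fun x : R => x = 0).
  split; first by move/eqP; rewrite oner_eq0.
  by move=> a b /eqP; rewrite mulf_eq0 => /orP[]/eqP; [left | right].
have [|L [g [s [subL ps sL Lp]]]] := functional_mod_prime fgC pr.
  exact: homothety_injective.
have [f fP] := choice sL.
have fE c b : L (s *: c - b *: g) -> f c = b.
  move=> Lb; apply/eqP; rewrite -subr_eq0; apply/eqP/Lp.
  exact: coefficient_unique Lb (fP c).
have f_lin : linear (f : C -> R^o).
  move=> b u v; apply: fE; rewrite -[b *: (f u : R^o)]/(b * f u).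
  exact: coefficient_linear.
exists (linear_map f_lin), g => /=; rewrite (fE g s) // subrr.
exact: submodule0.
Qed.

(** The endomorphism [c |-> f c *: n] is the homothety by some [r]; applying
    [f] to [f c *: n = r *: c] at a [c] with [f c <> 0] gives [r = f n]. *)
Lemma functional_swap (f : {linear C -> R^o}) (c n : C) : f c *: n = f n *: c.
Proof.
have [f0|fN0] := pselect (forall c, f c = 0); first by rewrite !f0 !scale0r.
have [r rE] : exists r, forall c, f c *: n = r *: c.
  apply: homothety_surjective => a u v.
  by rewrite linearP scalerDl -[a *: f u]/(a * f u) scalerA.
have [g fg] : exists g, f g <> 0 by apply/existsNP.
have := congr1 f (rE g); rewrite !linearZ /= -[_ *: _]/(_ * _) mulrC.
by move/(mulIf (introN eqP fg)) => ->; rewrite rE.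
Qed.

(** An associated prime of [C / x C] annihilates a nonzero element of
    [R / x R].  The map [phi : C -> R / p -> C / x C], with [1 |-> n] as second
    map, is lifted to [C] by splitting the pullback [G] of [C -> C / x C] along
    [phi], an extension of [C] by [x C], hence by [C]. *)
Lemma associated_prime_mod_multiple (x : R) (n : C) :
  x <> 0 -> prime_set (fun a => exists c : C, a *: n = x *: c) ->
  exists r, (forall t, r <> x * t) /\
    forall q, (exists c : C, q *: n = x *: c) -> exists t, q * r = x * t.
Proof.
move=> x0 pr; have [fgC _ Ext1] := sdC.
have [|L [g [s [subL ps sL Lp]]]] := functional_mod_prime fgC pr.
  by move=> t /homothety_injective->; exists 0; rewrite scale0r scaler0.
pose G (u : C * C) := exists a : R,
  L (s *: u.1 - a *: g) /\ exists d, u.2 - a *: n = x *: d.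
have subG : submodule G.
  split=> [|b u v [a [La [d aE]]] [a' [La' [d' aE']]]].
    exists 0; rewrite /= !scaler0 !scale0r subrr; split.
      exact: submodule0.
    by exists 0; rewrite scaler0.
  exists (b * a + a') => /=; split; last exists (b *: d + d').
    exact: coefficient_linear.
  rewrite scalerDl -scalerA opprD addrACA -scalerBr aE aE' scalerDr.
  by rewrite !scalerA mulrC.
have xinj (u v : C) : x *: u = x *: v -> u = v.
  move/eqP; rewrite -subr_eq0 -scalerBr => /eqP/semidualizing_torsionfree[] //.
  by move/eqP; rewrite subr_eq0 => /eqP.
pose E : lmodType R := submodule_type subG.
have iG (c : C) : G (0, x *: c).
  exists 0; rewrite /= !scaler0 !scale0r !subr0; split; last by exists c.
  exact: submodule0.
have i_lin : linear (fun c => submodule_elt subG (iG c) : E).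
  move=> a u v; apply: val_inj; rewrite [RHS]linearP /=.
  apply: injective_projections => /=; first by rewrite scaler0 addr0.
  by rewrite scalerDr !scalerA mulrC.
have p_lin : linear (fun e : E => (val e).1) by move=> a u v; rewrite linearP.
have [||e|S SE] := @Ext1_vanishes_split _ _ _ _ (linear_map i_lin)
  (linear_map p_lin) (Ext1 1%N isT).
- by move=> u v /(congr1 val) [/xinj].
- move=> c; have [a La] := sL c.
  have Gc : G (c, a *: n).
    by exists a; split=> //; exists 0; rewrite /= subrr scaler0.
  by exists (submodule_elt subG Gc).
- split=> [/= e0|[c <-]] //; have [a [La [d dE]]] := submodule_typeP e.
  move: La dE; rewrite e0 scaler0 sub0r => La dE.
  have [|d' dE'] := Lp a.
    by rewrite -[_ *: _]opprK -scaleN1r; apply: submoduleZ.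
  exists (d + d'); apply: val_inj; rewrite [RHS]surjective_pairing e0 /=.
  by rewrite scalerDr -dE -dE' subrK.
have [r rE] : exists r, forall c, (val (S c)).2 = r *: c.
  by apply: homothety_surjective => a u v; rewrite !linearP.
have {rE} rG c : exists a,
    L (s *: c - a *: g) /\ exists d, r *: c - a *: n = x *: d.
  by have := submodule_typeP (S c); rewrite /G rE [X in s *: X]SE.
exists r; split=> [t rt | q [c0 qn]].
  (* The value of [phi] at [g] is the class of [s *: n], which is not 0. *)
  have [a [La [d dE]]] := rG g.
  have /Lp[e eE] : L ((s - a) *: g) by rewrite scalerBl.
  apply: ps; exists (t *: g - d + e).
  rewrite -[s](subrK a) scalerDl eE -[a *: n](subKr (r *: g)) dE rt -scalerA.
  by rewrite -scalerBr -scalerDr addrC.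
have qr (c : C) : exists d, (q * r) *: c = x *: d.
  have [a [_ [d dE]]] := rG c; exists (q *: d + a *: c0).
  rewrite -scalerA -[r *: c](subrK (a *: n)) dE !scalerDr !scalerA.
  rewrite [q * a]mulrC -[(a * q) *: n]scalerA qn scalerA.
  by rewrite [q * x]mulrC [a * x]mulrC.
have [d dE] := choice qr.
have [t tE] : exists t, forall c, d c = t *: c.
  apply: homothety_surjective => a u v; apply: xinj.
  by rewrite -dE !scalerDr -!dE !scalerA [x * a]mulrC -[a * x *: _]scalerA -dE
    scalerA [a * _]mulrC.
exists t; apply/eqP; rewrite -subr_eq0; apply/eqP/homothety_injective => c.
by rewrite scalerBl dE tE scalerA subrr.
Qed.

End Semidualizing.

(** * Almost integral elements of a Noetherian normal domain *)

Section NormalDomain.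
Variable R : idomainType.

Local Notation K := {fraction R}.
Local Notation toK := (@FracField.tofrac R).

Lemma tofrac_neq0 (x : R) : x <> 0 -> toK x != 0.
Proof. by move/eqP; rewrite tofrac_eq0. Qed.

(** The ideals spanned by the first [k] elements [c * y ^+ i] of [R] form a
    stationary chain, which expresses some [c * y ^+ k] through lower powers.
    Cancelling [c] gives an equation of integral dependence. *)
Lemma almost_integral_normal (y : K) (c : R) :
  noetherian R -> normal_domain R -> c <> 0 ->
  (forall k, exists t, toK c * y ^+ k = toK t) -> exists r, y = toK r.
Proof.
move=> noeth normal /tofrac_neq0 c0 /choice[t tE]; apply: normal.
pose F k (x : R^o) := exists a : nat -> R, x = \sum_(i < k) a i * t i.
have [k|k x [a ->]|k stat] := @noetherian_chain_stationary R F noeth.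
- split=> [|a u v [b ->] [b' ->]].
    by exists (fun=> 0); rewrite big1 // => i _; rewrite mul0r.
  exists (fun i => a * b i + b' i).
  rewrite -[a *: _]/(a * _) mulr_sumr -big_split /=.
  by apply: eq_bigr => i _; rewrite mulrDl mulrA.
- exists (fun i => if (i < k)%N then a i else 0).
  rewrite big_ord_recr /= ltnn mul0r addr0.
  by apply: eq_bigr => i _; rewrite ltn_ord.
have [a tk] : F k (t k).
  apply: (stat k.+1); exists (fun i => (i == k)%:R).
  rewrite big_ord_recr /= eqxx mul1r big1 ?add0r // => i _.
  by rewrite ltn_eqF // mul0r.
exists ('X^k - \poly_(i < k) a i).
  rewrite monicE lead_coefDl ?lead_coefXn // size_polyXn size_polyN ltnS.
  exact: size_poly.
rewrite rmorphB /= map_polyXn rootE hornerD hornerN hornerXn subr_eq0.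
rewrite -(inj_eq (mulfI c0)) tE tk rmorph_sum poly_def rmorph_sum horner_sum.
rewrite mulr_sumr; apply/eqP/eq_bigr => i _.
by rewrite /= map_polyZ map_polyXn hornerZ hornerXn mulrCA tE -rmorphM.
Qed.
End NormalDomain.

(** * Rank one *)

Section Rank.
Variable R : idomainType.
Local Notation K := {fraction R}.
Local Notation toK := (@FracField.tofrac R).

(** The functional [f] itself, followed by [R -> K], realizes the extension of
    scalars: a semilinear [h] out of [C] must extend to
    [z |-> (z / f g) *: h g], and [f c *: g = f g *: c] shows that it does. *)
Lemma has_rank1 (C : lmodType R) (f : {linear C -> R^o}) (g : C) :
  f g <> 0 -> (forall c n, f c *: n = f n *: c) -> has_rank C 1.
Proof.
move=> fg0 swap.
have j_lin : linear_for (toK \; *:%R) (fun c => toK (f c) : K^o).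
  by move=> a u v; rewrite linearP rmorphD rmorphM.
pose j : {linear C -> K^o | toK \; *:%R} :=
  HB.pack_for {linear C -> K^o | toK \; *:%R} (fun c => toK (f c) : K^o)
    (GRing.isLinear.Build R C K^o (toK \; *:%R)
       (fun c => toK (f c) : K^o) j_lin).
exists K^o, j; split; last by rewrite dimvf.
move=> W h.
have fgK : toK (f g) != 0 by rewrite tofrac_eq0; apply/eqP.
have k_lin : linear (fun z : K^o => ((z : K) / toK (f g)) *: h g : W).
  by move=> a u v; rewrite -[a *: u]/(a * u) mulrDl scalerDl scalerA mulrA.
exists (linear_map k_lin : HomMod K^o W); split=> [c /=|k kE].
  have := congr1 h (swap c g).
  rewrite !linearZ /= => hfg.
  by rewrite mulrC -scalerA hfg scalerK.
apply: hom_ext => z /=; rewrite -kE -linearZ /=; congr (k _).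
exact: divfK.
Qed.
End Rank.

(** * Reflexivity *)

Section Reflexive.
Variables (R : idomainType) (C : lmodType R).
Local Notation toK := (@FracField.tofrac R).
Hypotheses (noeth : noetherian R) (normal : normal_domain R).
Hypothesis sdC : semidualizing C.

(** The prime supplied by [exists_prime_annihilator], applied to the image [N]
    of [C] in its bidual, contains all values of all functionals.  This makes
    the dual of [C] stable under an element of the fraction field that is not
    in [R], which almost integrality forbids. *)
Lemma semidualizing_reflexive : reflexive_module C.
Proof.
have [fgC _ _] := sdC; split=> //.
have [f [g fg0]] := semidualizing_functional sdC.
have swap (h k : dual C) (c : C) :
    (h : HomMod C R^o) c *: k = (k : HomMod C R^o) c *: h.
  apply: hom_ext => n.
  have := congr1 (k : HomMod C R^o) (functional_swap sdC h c n).
  by rewrite !linearZ /= -![_ *: _]/(_ * _) => ->; rewrite mulrC.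
have finj (u v : C) : f u = f v -> u = v.
  move=> fuv; apply/eqP; rewrite -subr_eq0; apply/eqP.
  have := functional_swap sdC f (u - v) g; rewrite linearB fuv subrr scale0r.
  by move/esym/(semidualizing_torsionfree noeth sdC); case.
pose N (xi : dual (dual C)) := exists c, biduality c = xi.
have bid_inj : injective (@biduality _ C).
  by move=> u v /(congr1 (fun xi : HomMod (dual C) R^o => xi f)) /finj.
suff /choice[b bK] : forall xi, N xi.
  by exists b => [c|xi //]; apply: bid_inj; rewrite bK.
have subN : submodule N.
  split=> [|a u v [c <-] [d <-]]; first by exists 0; rewrite linear0.
  by exists (a *: c + d); rewrite linearP.
move=> xi0; apply: contrapT => Nxi0.
have [xi [Nxi _ pr]] := exists_prime_annihilator noeth subN Nxi0.
pose ev (h : dual C) : R := (xi : HomMod (dual C) R^o) h.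
have evZ a h : ev (a *: h) = a * ev h by rewrite /ev linearZ.
have bidE (c : C) (h : dual C) :
  biduality (ev h *: c) = (h : HomMod C R^o) c *: xi.
  apply: hom_ext => k; rewrite /= /evaluation linearZ.
  rewrite -[RHS]/((h : HomMod C R^o) c * ev k) -evZ swap evZ.
  by rewrite -[LHS]/(_ * _) mulrC.
(* [f g *: xi] is the image of [ev f *: g], so the annihilator of [xi]
   modulo [C] is that of [ev f *: g] modulo [f g *: C]. *)
have pE a : N (a *: xi) <-> exists c, a *: (ev f *: g) = f g *: c.
  split=> [[c cE]|[c cE]]; exists c.
    apply: bid_inj; rewrite [LHS]linearZ /= bidE.
    by rewrite [RHS]linearZ /= cE !scalerA mulrC.
  apply: hom_ext => h; apply: (mulfI (introN eqP fg0)).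
  have := congr1 (@biduality _ C) cE.
  rewrite [LHS]linearZ /= bidE [RHS]linearZ /=.
  move=> /(congr1 (fun z : HomMod (dual C) R^o => z h)) /= e.
  rewrite -[LHS]/(f g *: _) -e.
  exact: mulrCA.
have [|r [rN rP]] :=
  @associated_prime_mod_multiple _ _ noeth sdC (f g) (ev f *: g) fg0.
- case: pr => p1 pM; split=> [/pE//|a b /pE/pM[]/pE]; by [left|right].
have stable (h : HomMod C R^o) : exists h' : HomMod C R^o,
    forall c, r * h c = f g * h' c.
  have /choice[h' h'E] : forall c, exists t, r * h c = f g * t.
    move=> c; rewrite mulrC; apply: rP; apply/pE; exists (ev h *: c).
    exact: bidE.
  have h'_lin : linear (h' : C -> R^o).
    move=> a u v; apply: (mulfI (introN eqP fg0)); rewrite -h'E linearP.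
    rewrite -[a *: (h' u : R^o)]/(a * h' u) -[a *: h u]/(a * h u).
    by rewrite !mulrDr mulrCA !h'E mulrCA.
  by exists (linear_map h'_lin).
have powers k : exists h : HomMod C R^o,
    forall c, r ^+ k * f c = f g ^+ k * h c.
  elim: k => [|k [h hE]]; first by exists f => c; rewrite !expr0.
  have [h' h'E] := stable h; exists h' => c.
  by rewrite exprS -mulrA hE mulrCA h'E mulrA -exprSr.
pose s : R := f g.
have sK : toK s != 0 := @tofrac_neq0 R s fg0.
have [k|r' r'E] :=
  @almost_integral_normal R (toK r / toK s) s noeth normal fg0.
  have [h /(_ g) hE] := powers k; exists (h g).
  have skK : toK s ^+ k != 0 by apply: expf_neq0.
  apply: (mulfI skK); rewrite -!rmorphXn -[RHS]rmorphM -hE.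
  rewrite rmorphM mulrCA !rmorphXn expr_div_n.
  by rewrite [X in _ * X]mulrC divfK // mulrC.
apply: (rN r'); apply/eqP.
by rewrite -(tofrac_eq r) tofracM -r'E mulrC divfK.
Qed.
End Reflexive.

Theorem proposition3p4 (R : idomainType)
    (Rnoeth : noetherian R) (Rnormal : normal_domain R) :
  (forall C : lmodType R, semidualizing C ->
     reflexive_module C /\ has_rank C 1) /\
  (exists iota : S0 R -> Cl R,
     injective iota /\
     forall (x : S0 R) (C : lmodType R), semidualizing C ->
       sval x = iso_class C -> sval (iota x) = iso_class C).
Proof.
have main (C : lmodType R) :
    semidualizing C -> reflexive_module C /\ has_rank C 1.
  move=> sdC; split; first exact: semidualizing_reflexive.
  have [f [g fg0]] := semidualizing_functional sdC.
  exact: has_rank1 fg0 (functional_swap sdC f).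
split=> //.
have S0_Cl (x : S0 R) : exists2 M, reflexive_module M /\ has_rank M 1 &
    sval x = iso_class M.
  by case: x => X [C sdC XC]; exists C => //; exact: main.
exists (fun x => exist _ (sval x) (S0_Cl x)); split=> // -[X hX] [Y hY] XY.
have {}XY : X = Y := congr1 sval XY.
by subst Y; congr exist; apply: Prop_irrelevance.
Qed.
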